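(* Let $F=f+h$ on $\mathcal{M}=\mathrm{St}(n,r)$ satisfy the standing assumptions, let $X_0\in\mathcal{M}$ and $\gamma\in(0,1)$, and let $\{X_k\}$ be generated by the ManPG algorithm with stepsize parameter $t>0$. Then every limit point of the sequence $\{X_k\}$ is a stationary point of the problem $\min_{X\in\mathcal{M}}F(X)$. Moreover, for every $\epsilon>0$, the ManPG algorithm with $t=1/L$ (stopped as soon as $\|V_k\|_F\le \epsilon/L$) returns an $\epsilon$-stationary point of this problem in at most $$\left\lceil \frac{2L\,(F(X_0)-F^* )}{\gamma\,\bar{\alpha}\,\epsilon^2}\right\rceil$$ iterations, where $F^*=\min_{X\in\mathcal{M}}F(X)$ is the optimal value and $\bar{\alpha}=\dfrac{1}{2(c_0+L_hM_2)t}$ with $t=1/L$ and $c_0=M_2G+LM_1^2/2$.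
   Context: Notation: $\|\cdot\|_F$ is the Frobenius norm and $\langle A,B\rangle=\mathrm{Tr}(A^\top B)$ on $\mathbb{R}^{n\times r}$, with $r\le n$. $\mathcal{M}=\mathrm{St}(n,r)=\{X\in\mathbb{R}^{n\times r}: X^\top X=I_r\}$ is the Stiefel manifold, an embedded submanifold of $\mathbb{R}^{n\times r}$ with the Riemannian metric induced by $\langle\cdot,\cdot\rangle$. Its tangent space is $\mathrm{T}_X\mathcal{M}=\{V: V^\top X+X^\top V=0\}$, and $\mathrm{Proj}_{\mathrm{T}_X\mathcal{M}}$ is the orthogonal projection onto it. The Riemannian gradient is $\mathrm{grad}\,f(X)=\mathrm{Proj}_{\mathrm{T}_X\mathcal{M}}\nabla f(X)$. Standing assumptions: the problem is $\min_{X\in\mathcal{M}}F(X):=f(X)+h(X)$, where $f:\mathbb{R}^{n\times r}\to\mathbb{R}$ is smooth, possibly nonconvex, with $\nabla f$ Lipschitz continuous with constant $L>0$; $h:\mathbb{R}^{n\times r}\to\mathbb{R}$ is convex, possibly nonsmooth, and Lipschitz continuous with constant $L_h$ (all these properties are in the ambient Euclidean space with Frobenius norm). $\partial h$ is the convex subdifferential. Retraction: $\mathrm{Retr}$ is a fixed smooth map from the tangent bundle $\mathrm{T}\mathcal{M}$ to $\mathcal{M}$ with restrictions $\mathrm{Retr}_X$ to $\mathrm{T}_X\mathcal{M}$, such that for all $X\in\mathcal{M}$, $\mathrm{Retr}_X(0)=X$ and $\lim_{\mathrm{T}_X\mathcal{M}\ni\xi\to0}\|\mathrm{Retr}_X(\xi)-(X+\xi)\|_F/\|\xi\|_F=0$.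 Constants: $M_1,M_2>0$ are constants such that $\|\mathrm{Retr}_X(\xi)-X\|_F\le M_1\|\xi\|_F$ and $\|\mathrm{Retr}_X(\xi)-(X+\xi)\|_F\le M_2\|\xi\|_F^2$ for all $X\in\mathcal{M}$, $\xi\in\mathrm{T}_X\mathcal{M}$ (these exist since $\mathcal{M}$ is compact). $G>0$ is a constant with $\|\nabla f(X)\|_F\le G$ for all $X\in\mathcal{M}$. ManPG algorithm (input $X_0\in\mathcal{M}$, $\gamma\in(0,1)$, $t>0$): for $k=0,1,\dots$, let $V_k$ be the unique minimizer over $V\in\mathrm{T}_{X_k}\mathcal{M}$ of $\langle\nabla f(X_k),V\rangle+\frac{1}{2t}\|V\|_F^2+h(X_k+V)$; set $\alpha=1$; while $F(\mathrm{Retr}_{X_k}(\alpha V_k))>F(X_k)-\frac{\alpha\|V_k\|_F^2}{2t}$, replace $\alpha$ by $\gamma\alpha$; then set $X_{k+1}=\mathrm{Retr}_{X_k}(\alpha V_k)$. A point $X\in\mathcal{M}$ is a stationary point if $0\in\mathrm{grad}\,f(X)+\mathrm{Proj}_{\mathrm{T}_X\mathcal{M}}(\partial h(X))$. A point $X_k\in\mathcal{M}$ is an $\epsilon$-stationary point if the unique minimizer $V_k$ over $V\in\mathrm{T}_{X_k}\mathcal{M}$ of $\langle\nabla f(X_k),V\rangle+\frac{1}{2t}\|V\|_F^2+h(X_k+V)$ with $t=1/L$ satisfies $\|V_k\|_F\le\epsilon/L$. *)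

(* Defs.v *)
From mathcomp Require Import all_boot all_order all_algebra.
From mathcomp Require Import all_classical all_reals all_analysis.

Set Implicit Arguments.
Unset Strict Implicit.
Unset Printing Implicit Defensive.

Import Order.TTheory GRing.Theory Num.Theory numFieldNormedType.Exports.
Local Open Scope classical_set_scope.
Local Open Scope ring_scope.

(* The library norm on matrices is the max norm, which induces the same topology
   (hence the same differentiability and limit points) as the Frobenius norm,
   but all quantitative bounds refer to the latter. *)
Definition finner (R : realType) (n r : nat) (A B : 'M[R]_(n, r)) : R :=
  \tr (A^T *m B).

Definition fnorm (R : realType) (n r : nat) (A : 'M[R]_(n, r)) : R :=
  Num.sqrt (finner A A).

Definition egrad (R : realType) (n r : nat) (f : 'M[R]_(n, r) -> R)
    (X : 'M[R]_(n, r)) : 'M[R]_(n, r) :=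
  \matrix_(i, j) 'D_(delta_mx i j) f X.

Definition subdifferential (R : realType) (n r : nat)
    (h : 'M[R]_(n, r) -> R) (X : 'M[R]_(n, r)) : set 'M[R]_(n, r) :=
  [set D | forall Y, h X + finner D (Y - X) <= h Y].

Definition Stiefel (R : realType) (n r : nat) : set 'M[R]_(n, r) :=
  [set X | X^T *m X = 1%:M].

Definition tangent (R : realType) (n r : nat) (X : 'M[R]_(n, r)) :
    set 'M[R]_(n, r) :=
  [set V | V^T *m X + X^T *m V = 0].

(* The set under [xget] is a singleton, tangent X being a linear subspace. *)
Definition tproj (R : realType) (n r : nat) (X Y : 'M[R]_(n, r)) :
    'M[R]_(n, r) :=
  xget 0 [set P | tangent X P /\
                  forall W, tangent X W -> finner (Y - P) W = 0].

Definition rgrad (R : realType) (n r : nat) (f : 'M[R]_(n, r) -> R)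
    (X : 'M[R]_(n, r)) : 'M[R]_(n, r) :=
  tproj X (egrad f X).

Definition stationary (R : realType) (n r : nat) (f h : 'M[R]_(n, r) -> R)
    (X : 'M[R]_(n, r)) : Prop :=
  Stiefel X /\ [set rgrad f X + P | P in tproj X @` subdifferential h X] 0.

(* For open U; in finite dimension this is the usual class C^k on U. *)
Fixpoint Ck_on (R : realType) (V W : normedModType R) (k : nat) (U : set V)
    (f : V -> W) : Prop :=
  match k with
  | 0 => forall x, U x -> {for x, continuous f}
  | k'.+1 => (forall x, U x -> differentiable f x) /\
             (forall v, Ck_on k' U (fun x => 'D_v f x))
  end.

(* C^infinity on a subset S of V: local C^infinity extensions exist. When S is
   an embedded submanifold this is smoothness on the manifold S. *)
Definition smooth_on (R : realType) (V W : normedModType R) (S : set V)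
    (f : V -> W) : Prop :=
  forall p, S p -> exists (U : set V) (g : V -> W),
    [/\ open U, U p, (forall k, Ck_on k U g) & {in U `&` S, g =1 f}].

Definition tangent_bundle (R : realType) (n r : nat) :
    set ('M[R]_(n, r) * 'M[R]_(n, r)) :=
  [set p | Stiefel p.1 /\ tangent p.1 p.2].

(* Retr X xi is only meaningful for X in Stiefel and xi in tangent X. *)
Definition retraction (R : realType) (n r : nat)
    (Retr : 'M[R]_(n, r) -> 'M[R]_(n, r) -> 'M[R]_(n, r)) : Prop :=
  [/\ forall X xi, Stiefel X -> tangent X xi -> Stiefel (Retr X xi),
      smooth_on (@tangent_bundle R n r) (fun p => Retr p.1 p.2),
      forall X, Stiefel X -> Retr X 0 = X &
      forall X, Stiefel X ->
        fnorm (Retr X xi - (X + xi)) / fnorm xi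
          @[xi --> within (tangent X) (0 : 'M[R]_(n, r))^']
          --> (0 : R)].

Definition model (R : realType) (n r : nat) (f h : 'M[R]_(n, r) -> R) (t : R)
    (X V : 'M[R]_(n, r)) : R :=
  finner (egrad f X) V + (2 * t)^-1 * fnorm V ^+ 2 + h (X + V).

Definition argmin_model (R : realType) (n r : nat) (f h : 'M[R]_(n, r) -> R)
    (t : R) (X : 'M[R]_(n, r)) : set 'M[R]_(n, r) :=
  [set V | tangent X V /\
           forall W, tangent X W -> model f h t X V <= model f h t X W].

Definition unique_dir (R : realType) (n r : nat) (f h : 'M[R]_(n, r) -> R)
    (t : R) (X V : 'M[R]_(n, r)) : Prop :=
  argmin_model f h t X = [set V].

Definition accept (R : realType) (n r : nat) (f h : 'M[R]_(n, r) -> R)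
    (Retr : 'M[R]_(n, r) -> 'M[R]_(n, r) -> 'M[R]_(n, r)) (t : R)
    (X V : 'M[R]_(n, r)) (alpha : R) : Prop :=
  f (Retr X (alpha *: V)) + h (Retr X (alpha *: V)) <=
    f X + h X - alpha * fnorm V ^+ 2 / (2 * t).

(* The while loop ends with alpha = gamma ^+ m for the first accepted m. *)
Definition ManPG_step (R : realType) (n r : nat) (f h : 'M[R]_(n, r) -> R)
    (Retr : 'M[R]_(n, r) -> 'M[R]_(n, r) -> 'M[R]_(n, r)) (gamma t : R)
    (X V X' : 'M[R]_(n, r)) : Prop :=
  unique_dir f h t X V /\
  exists m : nat,
    [/\ accept f h Retr t X V (gamma ^+ m),
        forall j, (j < m)%N -> ~ accept f h Retr t X V (gamma ^+ j) &
        X' = Retr X (gamma ^+ m *: V)].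

Definition ManPG_seq (R : realType) (n r : nat) (f h : 'M[R]_(n, r) -> R)
    (Retr : 'M[R]_(n, r) -> 'M[R]_(n, r) -> 'M[R]_(n, r)) (gamma t : R)
    (X0 : 'M[R]_(n, r)) (X : nat -> 'M[R]_(n, r)) : Prop :=
  X 0%N = X0 /\
  exists V : nat -> 'M[R]_(n, r),
    forall k, ManPG_step f h Retr gamma t (X k) (V k) (X k.+1).

(* The run from X0, stopped at the first k with fnorm (V k) <= tol, performs
   exactly K updates and returns Y; entries of X and V beyond K are junk. *)
Definition ManPG_returns (R : realType) (n r : nat) (f h : 'M[R]_(n, r) -> R)
    (Retr : 'M[R]_(n, r) -> 'M[R]_(n, r) -> 'M[R]_(n, r)) (gamma t tol : R)
    (X0 : 'M[R]_(n, r)) (K : nat) (Y : 'M[R]_(n, r)) : Prop :=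
  exists X V : nat -> 'M[R]_(n, r),
    [/\ X 0%N = X0,
        forall k, (k < K)%N ->
          tol < fnorm (V k) /\ ManPG_step f h Retr gamma t (X k) (V k) (X k.+1),
        unique_dir f h t (X K) (V K),
        fnorm (V K) <= tol &
        Y = X K].

Definition eps_stationary (R : realType) (n r : nat)
    (f h : 'M[R]_(n, r) -> R) (L eps : R) (X : 'M[R]_(n, r)) : Prop :=
  Stiefel X /\ exists2 V, unique_dir f h L^-1 X V & fnorm V <= eps / L.

(* Main.v *)
From HB Require Import structures.
Require Import Defs.
From mathcomp Require Import all_boot all_order all_algebra.
From mathcomp Require Import all_classical all_reals all_analysis.
From mathcomp Require Import ring lra.
Import Order.TTheory GRing.Theory Num.Theory numFieldNormedType.Exports.
Local Open Scope classical_set_scope.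
Local Open Scope ring_scope.

(** Write [F = f + h]. The proof rests on a decrease inequality for the
subproblem at a point [X] of the Stiefel manifold, whose minimizer over the
tangent space is [V]. The model is strongly convex along the segment from [0]
to [V], so that minimality of [V] gives
  <grad f X, V> + h (X + V) - h X <= - |V|^2 / t
([argmin_model_decrease]). Moving to [Retr X (a V)] instead of [X + a V]
costs only second-order terms: the descent lemma for [f], the Lipschitz bound
for [h] and the two retraction bounds show that the loss is at most
[c a^2 |V|^2] with [c = M2 G + L M1^2 / 2 + Lh M2]. Hence every
[a <= min 1 (1 / (2 c t))] passes the line search ([sufficient_decrease]),
backtracking never shrinks the step below
[min 1 (gamma / (2 c t))], and each iteration lowers [F] by at least this
number times [|V|^2 / (2 t)] ([ManPG_step_decrease]).

Complexity. While [|V k| > eps / L] the objective drops by a fixed amount, and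
[F] cannot go below its infimum, so telescoping bounds the number of steps
([complexity_bound]). The stated bound has [gamma * abar] rather than
[min 1 (gamma * abar)]; the two agree because [M1 >= 1] as soon as a nonzero
tangent vector exists ([retraction_constant_ge1]), which forces [abar <= 1].

Limit points. [F] is bounded below and nonincreasing along the run, hence its
decrements, and with them [V k], tend to [0]. If [X k] accumulates at [Y],
comparing [V k] with the projection to the tangent space at [X k] of a vector
tangent at [Y] and passing to the limit shows that [0] minimizes the model
at [Y] ([argmin_model_limit]). Minimality at [0] says that the linear form
[- <grad f Y, .>] is dominated by [h (Y + .) - h Y] on the tangent space. The
Hahn-Banach theorem extends it to a form dominated everywhere, that is, to a
subgradient [D] of [h] at [Y] which agrees with [- grad f Y] on tangent
vectors; projecting gives stationarity ([stationary_of_argmin0]).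

Existence of the minimizer of the model comes from strong convexity alone: a
minimizing sequence is Cauchy by the midpoint inequality, and the space of
matrices is complete ([argmin_model_exists]). Limits are handled by
inequalities with an error proportional to a small [e] ([le_of_small_error]),
all distances being measured in the Frobenius norm. *)

Set Implicit Arguments.
Unset Strict Implicit.
Unset Printing Implicit Defensive.

(** * The Frobenius inner product and norm *)

Lemma finnerE (R : realType) (n r : nat) (A B : 'M[R]_(n, r)) :
  finner A B = \sum_i \sum_j A i j * B i j.
Proof.
rewrite /finner /mxtrace exchange_big /=.
apply: eq_bigr => j _; rewrite mxE.
by apply: eq_bigr => i _; rewrite mxE.
Qed.

Section FrobeniusInner.
Context (R : realType) (n r : nat).
Implicit Types (A B C : 'M[R]_(n, r)) (a : R).

Lemma finnerC A B : finner A B = finner B A.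
Proof. by rewrite !finnerE; do 2!apply: eq_bigr => ? _; rewrite mulrC. Qed.

Lemma finnerDl A B C : finner (A + B) C = finner A C + finner B C.
Proof. by rewrite /finner linearD/= mulmxDl linearD. Qed.

Lemma finnerZl a A B : finner (a *: A) B = a * finner A B.
Proof. by rewrite /finner linearZ/= -scalemxAl linearZ. Qed.

Lemma finnerNl A B : finner (- A) B = - finner A B.
Proof. by rewrite -scaleN1r finnerZl mulN1r. Qed.

Lemma finner0l A : finner 0 A = 0.
Proof. by rewrite -(scale0r 0) finnerZl mul0r. Qed.

Lemma finnerDr A B C : finner A (B + C) = finner A B + finner A C.
Proof. by rewrite finnerC finnerDl !(finnerC _ A). Qed.

Lemma finnerZr a A B : finner A (a *: B) = a * finner A B.
Proof. by rewrite finnerC finnerZl finnerC. Qed.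

Lemma finnerNr A B : finner A (- B) = - finner A B.
Proof. by rewrite finnerC finnerNl finnerC. Qed.

Lemma finner0r A : finner A 0 = 0.
Proof. by rewrite finnerC finner0l. Qed.

Definition finner_lin :=
  (finnerDl, finnerDr, finnerNl, finnerNr, finnerZl, finnerZr).

Lemma finner_ge0 A : 0 <= finner A A.
Proof.
by rewrite finnerE; do 2!apply: sumr_ge0 => ? _; rewrite -expr2 sqr_ge0.
Qed.

Lemma fnorm_ge0 A : 0 <= fnorm A. Proof. exact: sqrtr_ge0. Qed.

Lemma fnorm_sqr A : fnorm A ^+ 2 = finner A A.
Proof. by rewrite sqr_sqrtr ?finner_ge0. Qed.

Lemma sqr_entry_le A i j : A i j ^+ 2 <= finner A A.
Proof.
rewrite finnerE (bigD1 i)//= (bigD1 j)//= -addrA expr2 lerDl addr_ge0//.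
  by apply: sumr_ge0 => ? _; rewrite -expr2 sqr_ge0.
by do 2!apply: sumr_ge0 => ? _; rewrite -expr2 sqr_ge0.
Qed.

Lemma entry_le_fnorm A i j : `|A i j| <= fnorm A.
Proof. by rewrite -sqrtr_sqr ler_wsqrtr// sqr_entry_le. Qed.

Lemma fnorm_eq0 A : fnorm A = 0 -> A = 0.
Proof.
move=> A0; apply/matrixP => i j; rewrite mxE; apply/eqP.
by rewrite -normr_le0 -A0 entry_le_fnorm.
Qed.

Lemma fnorm0 : fnorm (0 : 'M[R]_(n, r)) = 0.
Proof. by rewrite /fnorm finner0l sqrtr0. Qed.

Lemma fnormZ a A : fnorm (a *: A) = `|a| * fnorm A.
Proof.
by rewrite /fnorm finnerZl finnerZr mulrA -expr2 sqrtrM ?sqr_ge0// sqrtr_sqr.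
Qed.

Lemma fnormN A : fnorm (- A) = fnorm A.
Proof. by rewrite -scaleN1r fnormZ normrN1 mul1r. Qed.

Lemma fnormC A B : fnorm (A - B) = fnorm (B - A).
Proof. by rewrite -opprB fnormN. Qed.

(** Nonnegativity of the squared norm of [<A,A> B - <A,B> A], which equals
[<A,A> (<A,A> <B,B> - <A,B>^2)]. *)
Lemma fnorm_sqr_ineq A B : finner A B ^+ 2 <= finner A A * finner B B.
Proof.
have [->|/eqP A0] := pselect (A = 0); first by rewrite !finner0l expr0n mul0r.
have a0 : 0 < finner A A.
  rewrite lt_neqAle finner_ge0 andbT eq_sym; apply: contra A0 => /eqP AA.
  by apply/eqP/fnorm_eq0; rewrite /fnorm AA sqrtr0.
have := finner_ge0 (finner A A *: B - finner A B *: A).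
rewrite !finner_lin (finnerC B A) => H.
have : 0 <= finner A A * (finner A A * finner B B - finner A B ^+ 2).
  by apply: le_trans H _; rewrite le_eqVlt; apply/orP; left; apply/eqP; ring.
by rewrite pmulr_rge0// subr_ge0.
Qed.

Lemma cauchy_schwarz A B : `|finner A B| <= fnorm A * fnorm B.
Proof.
rewrite -sqrtr_sqr -sqrtrM ?finner_ge0// ler_wsqrtr//; exact: fnorm_sqr_ineq.
Qed.

Lemma finner_le A B : finner A B <= fnorm A * fnorm B.
Proof. by apply: le_trans (cauchy_schwarz A B); exact: ler_norm. Qed.

Lemma fnormD A B : fnorm (A + B) <= fnorm A + fnorm B.
Proof.
rewrite -ler_sqr ?nnegrE ?addr_ge0 ?fnorm_ge0// sqrrD !fnorm_sqr !finner_lin.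
by rewrite (finnerC B A); have := finner_le A B; lra.
Qed.

Lemma fnorm_triangle A B C : fnorm (A - B) <= fnorm (A - C) + fnorm (C - B).
Proof. by have := fnormD (A - C) (C - B); rewrite addrA subrK. Qed.

(** With [mx_norm_le_fnorm], this transfers completeness and cluster points
from the max norm, which carries the topology, to the Frobenius norm. *)
Lemma le_fnorm_mx_norm A : fnorm A <= Num.sqrt (n * r)%:R * `|A|.
Proof.
rewrite -(ger0_norm (normr_ge0 A)) -[`| `|A| |]sqrtr_sqr -sqrtrM ?ler0n//.
rewrite ler_wsqrtr// finnerE.
have entry i j : A i j * A i j <= `|A| ^+ 2.
  rewrite -expr2 -real_normK ?num_real// lerXn2r ?nnegrE//.
  rewrite [leRHS]/Num.norm/= mx_normrE; apply/bigmax_geP; right => /=.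
  by exists (i, j).
apply: (@le_trans _ _ (\sum_(i < n) \sum_(j < r) `|A| ^+ 2)).
  by apply: ler_sum => i _; apply: ler_sum => j _.
by rewrite !sumr_const !card_ord -mulrnA mulr_natl mulnC.
Qed.

Lemma mx_norm_le_fnorm A : `|A| <= fnorm A.
Proof.
rewrite [leLHS]/Num.norm/= mx_normrE; apply/bigmax_leP; split=> [|ij _].
  exact: fnorm_ge0.
exact: entry_le_fnorm.
Qed.

End FrobeniusInner.

Lemma fnorm_tr (R : realType) (n r : nat) (A : 'M[R]_(n, r)) :
  fnorm A^T = fnorm A.
Proof.
rewrite /fnorm !finnerE exchange_big /=; congr Num.sqrt.
by do 2!apply: eq_bigr => ? _; rewrite !mxE.
Qed.

(** Cauchy-Schwarz for each entry of the product, a row of [A] against a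
column of [B], summed over all entries. *)
Lemma fnormM (R : realType) (m n r : nat) (A : 'M[R]_(m, n)) (B : 'M[R]_(n, r)) :
  fnorm (A *m B) <= fnorm A * fnorm B.
Proof.
rewrite -sqrtrM ?finner_ge0// ler_wsqrtr//.
have -> : finner A A * finner B B =
   \sum_i \sum_j (finner (row i A)^T (row i A)^T * finner (col j B) (col j B)).
  rewrite (finnerE A A) mulr_suml; apply: eq_bigr => i _.
  rewrite -mulr_sumr; congr (_ * _).
    rewrite finnerE exchange_big /= big_ord1.
    by apply: eq_bigr => j _; rewrite !mxE.
  rewrite finnerE exchange_big /=; apply: eq_bigr => j _.
  by rewrite finnerE exchange_big /= big_ord1; apply: eq_bigr => k _; rewrite !mxE.
rewrite finnerE; apply: ler_sum => i _; apply: ler_sum => j _.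
apply: le_trans (fnorm_sqr_ineq _ _); rewrite -expr2 le_eqVlt; apply/orP; left.
apply/eqP; congr (_ ^+ 2); rewrite finnerE exchange_big /= big_ord1 mxE.
by apply: eq_bigr => k _; rewrite !mxE.
Qed.

(** Replaces passages to the limit: estimates are proved with an explicit error
linear in [e], where [e <= 1] lets higher-order terms be absorbed in [c]. *)
Lemma le_of_small_error (R : realType) (a b c : R) :
  (forall e, 0 < e -> e <= 1 -> a <= b + c * e) -> a <= b.
Proof.
move=> H; apply/ler_addgt0Pr => e e0.
have c0 : 0 < `|c| + 1 by rewrite ltr_pwDr.
pose d := Num.min 1 (e / (`|c| + 1)).
have d0 : 0 < d by rewrite lt_min ltr01 divr_gt0.
apply: le_trans (H d d0 _) _; first by rewrite ge_min lexx.
rewrite lerD2l; apply: (@le_trans _ _ ((`|c| + 1) * d)).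
  by rewrite ler_wpM2r ?(ltW d0)// (le_trans (ler_norm c))// lerDl.
by rewrite mulrC -ler_pdivlMr// ge_min lexx orbT.
Qed.

Lemma eq0_of_fnorm_small (R : realType) (n r : nat) (A : 'M[R]_(n, r)) (c : R) :
  (forall e, 0 < e -> e <= 1 -> fnorm A <= c * e) -> A = 0.
Proof.
move=> H; apply: fnorm_eq0; apply/eqP; rewrite eq_le fnorm_ge0 andbT.
by apply: (@le_of_small_error _ _ _ c) => e e0 e1; rewrite add0r H.
Qed.

Lemma fnorm_complete (R : realType) (n r : nat) (u : nat -> 'M[R]_(n, r)) :
  (forall e, 0 < e -> exists N, forall i j, (N <= i)%N -> (N <= j)%N ->
     fnorm (u i - u j) < e) ->
  exists v, forall e, 0 < e -> exists N, forall i, (N <= i)%N ->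
     fnorm (v - u i) < e.
Proof.
move=> H.
have uc : cauchy (u @ \oo).
  apply/cauchy_exP => _/posnumP[e].
  have [N NP] := H e%:num (gt0 e).
  exists (u N); exists N => // i /= Ni.
  rewrite -ball_normE /ball_/=; apply: le_lt_trans (mx_norm_le_fnorm _) _.
  exact: NP.
have /cvg_ex[v uv] : cvg (u @ \oo) by exact: cauchy_cvg.
exists v => e e0; pose c : R := Num.sqrt (n * r)%:R + 1.
have c0 : 0 < c by rewrite ltr_pwDr ?sqrtr_ge0.
have /cvgrPdist_lt/(_ (e / c)) := uv; rewrite divr_gt0// => /(_ isT)[N _ NP].
exists N => i Ni; apply: le_lt_trans (le_fnorm_mx_norm _) _.
have := NP i Ni; rewrite /= ltr_pdivlMr// mulrC; apply: le_lt_trans.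
by rewrite ler_wpM2r// lerDl.
Qed.

(** * Separation of a linear form from a convex function *)

(** Riesz representation: the coordinates of the representing matrix are the
values of the form on the standard basis. *)
Lemma finner_represent (R : realType) (n r : nat) (g : 'M[R]_(n, r) -> R) :
  {morph g : u v / u + v} -> (forall a, {morph g : u / a *: u >-> a * u}) ->
  forall v, finner (\matrix_(i, j) g (delta_mx i j)) v = g v.
Proof.
move=> gD gZ v; have g0 : g 0 = 0 by rewrite -(scale0r 0) gZ mul0r.
have gsum m (F : 'I_m -> 'M[R]_(n, r)) : g (\sum_i F i) = \sum_i g (F i).
  exact: (big_morph g gD g0).
rewrite [v in RHS]matrix_sum_delta finnerE gsum; apply: eq_bigr => i _.
by rewrite gsum; apply: eq_bigr => j _; rewrite gZ mxE mulrC.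
Qed.

Lemma convex_functionE (R : realType) (E : lmodType R) (h : E -> R) :
  convex_function [set: E] h ->
  forall s A B, 0 <= s -> s <= 1 ->
    h (s *: A + (1 - s) *: B) <= s * h A + (1 - s) * h B.
Proof.
move=> hconv s A B s0 s1.
exact: (hconv (Itv01 s0 s1) A B (mem_set I) (mem_set I)).
Qed.

Section HahnBanach.
Context (R : realType) (n r : nat).
Implicit Types (U : {vspace 'M[R]_(n, r)}) (D e : 'M[R]_(n, r)).

(** With [P] the linear map [v |-> v - projv U v], whose kernel is [U], the form
[v |-> <P e, P v> / <P e, P e>] has the two properties, although [projv] is not
an orthogonal projection. *)
Lemma separating_functional U e : e \notin U ->
  exists E, (forall u, u \in U -> finner E u = 0) /\ finner E e = 1.
Proof.
move=> eU; set w := e - projv U e.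
have w0 : finner w w != 0.
  rewrite -fnorm_sqr sqrf_eq0; apply: contra eU => /eqP/fnorm_eq0/eqP.
  by rewrite subr_eq0 => /eqP ->; exact: memv_proj.
pose g v := finner w (v - projv U v) / finner w w.
exists (\matrix_(i, j) g (delta_mx i j)).
have gE v : finner (\matrix_(i, j) g (delta_mx i j)) v = g v.
  apply: finner_represent => [u1 u2|a u]; rewrite /g linearE.
    by rewrite opprD addrACA finnerDr mulrDl.
  by rewrite -scalerBr finnerZr mulrA.
split=> [u uU|]; rewrite gE /g; last by rewrite divff.
by rewrite projv_id// subrr finner0r mul0r.
Qed.

Variable phi : 'M[R]_(n, r) -> R.
Hypothesis phi_convex : forall s A B, 0 <= s -> s <= 1 ->
  phi (s *: A + (1 - s) *: B) <= s * phi A + (1 - s) * phi B.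

(** The one-dimensional extension step. A value [c] at [e] is admissible when it
lies above the slopes coming from [v - p e] and below those coming from
[u + s e], with [p, s > 0]. Every lower slope is at most every upper one: the
segment from [v - p e] to [u + s e] meets [U], where [phi] dominates the form,
and convexity compares that point with the end points. *)
Lemma hahn_banach_slope U D e :
  (forall u, u \in U -> finner D u <= phi u) ->
  exists c, forall u s, u \in U -> finner D u + s * c <= phi (u + s *: e).
Proof.
move=> DU.
pose lower := [set x | exists v p,
  [/\ v \in U, 0 < p & x = (finner D v - phi (v - p *: e)) / p]].
have cross u v s p : u \in U -> v \in U -> 0 < s -> 0 < p ->
  (finner D v - phi (v - p *: e)) / p <= (phi (u + s *: e) - finner D u) / s.
  move=> uU vU s0 p0; have sp0 : 0 < s + p by rewrite addr_gt0.
  have := phi_convex (u + s *: e) (v - p *: e) (ltW (divr_gt0 p0 sp0)).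
  have -> : 1 - p / (s + p) = s / (s + p) by field; rewrite gt_eqF.
  rewrite ler_pdivrMr// mul1r lerDr => /(_ (ltW s0)).
  (* z is the point of the segment that lies in U. *)
  set z := (X in phi X <= _).
  have zE : z = (p / (s + p)) *: u + (s / (s + p)) *: v.
    rewrite /z !scalerDr scalerN !scalerA addrACA.
    by rewrite [p / _ * s]mulrAC [s / _ * p]mulrAC [s * p]mulrC subrr addr0.
  have := DU z; rewrite {1}zE memvD ?memvZ// => /(_ isT).
  rewrite zE !finner_lin => H1 H2; have := le_trans H1 H2.
  rewrite ![_ / (s + p) * _]mulrAC -!mulrDl ler_pM2r ?invr_gt0// => H.
  rewrite ler_pdivrMr// [leRHS]mulrAC ler_pdivlMr//.
  by lra.
have lower_ub u s : u \in U -> 0 < s ->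
    ubound lower ((phi (u + s *: e) - finner D u) / s).
  by move=> uU s0 _ [v [p [vU p0 ->]]]; exact: cross.
have lower0 : lower !=set0.
  by exists ((finner D 0 - phi (0 - 1 *: e)) / 1), 0, 1; split; rewrite ?mem0v.
have lower_sup : has_sup lower.
  by split=> //; exists ((phi (0 + 1 *: e) - finner D 0) / 1);
     apply: lower_ub; rewrite ?mem0v.
exists (sup lower) => u s uU; have [s0|s0|->] := ltgtP s 0.
- have sN : 0 < - s by rewrite oppr_gt0.
  have : lower ((finner D u - phi (u + s *: e)) / - s).
    by exists u, (- s); split=> //; rewrite scaleNr opprK.
  by move=> /(ub_le_sup lower_sup.2); rewrite ler_pdivrMr//; lra.
- have := ge_sup lower0 (lower_ub u s uU s0).
  by rewrite ler_pdivlMr//; lra.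
- by rewrite mul0r scale0r !addr0; exact: DU.
Qed.

(** Induction on the codimension of [U]. The form is represented throughout by a
matrix, and is corrected at each step by a multiple of a form that vanishes on
the current subspace. *)
Lemma hahn_banach U D :
  (forall u, u \in U -> finner D u <= phi u) ->
  exists D', (forall u, u \in U -> finner D' u = finner D u) /\
             (forall v, finner D' v <= phi v).
Proof.
have [m] := ubnP (\dim (fullv : {vspace 'M[R]_(n, r)}) - \dim U)%N.
elim: m U D => // m IH U D; rewrite ltnS => Um DU.
have [UT|] := boolP (fullv <= U)%VS.
  by exists D; split=> // v; rewrite DU// (subvP UT)// memvf.
move=> /subvPn[e _ eU].
have [E [EU Ee]] := separating_functional eU.
have [c cP] := hahn_banach_slope e DU.
pose D1 := D + (c - finner D e) *: E.
have D1U u : u \in U -> finner D1 u = finner D u.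
  by move=> uU; rewrite !finner_lin EU// mulr0 addr0.
have [|u|D' [D'U D'phi]] := IH (U + <[e]>)%VS D1.
- apply: leq_trans Um; rewrite ltn_sub2l//.
    rewrite ltn_neqAle dimvS ?subvf// andbT; apply: contra eU => /eqP UT.
    have /eqP -> : U == fullv by rewrite eqEdim subvf UT leqnn.
    exact: memvf.
  rewrite ltn_neqAle dimvS ?addvSl// andbT; apply: contra eU => /eqP UT.
  have /eqP -> : U == (U + <[e]>)%VS by rewrite eqEdim addvSl UT leqnn.
  exact: (subvP (addvSr U <[e]>)) (memv_line e).
- move=> /memv_addP[v vU [w /vlineP[s ->] ->]].
  rewrite finnerDr D1U// finnerZr; apply: le_trans (cP v s vU).
  by rewrite !finner_lin Ee mulr1 [finner D e + _]addrC subrK.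
- exists D'; split=> // u uU; rewrite D'U ?D1U//.
  exact: (subvP (addvSl U <[e]>)).
Qed.

End HahnBanach.

(** * The descent lemma *)

Section DescentLemma.
Context (R : realType) (n r : nat).
Implicit Types (f : 'M[R]_(n, r) -> R) (X Y D : 'M[R]_(n, r)).

(** The gradient is defined by partial derivatives; differentiability makes it
compute all directional derivatives. *)
Lemma derive_egrad f X D : differentiable f X -> 'D_D f X = finner (egrad f X) D.
Proof.
move=> df; rewrite deriveE//.
rewrite -(@finner_represent _ _ _ ('d f X) (linearD _) (linearZ_LR _)).
by congr finner; apply/matrixP => i j; rewrite !mxE deriveE.
Qed.

Lemma is_derive_line f X D (s : R) : differentiable f (X + s *: D) ->
  is_derive s 1 (fun s : R => f (X + s *: D)) (finner (egrad f (X + s *: D)) D).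
Proof.
move=> df.
have E : (fun h : R => h^-1 *: (((fun s : R => f (X + s *: D)) \o shift s)
            (h *: 1) - f (X + s *: D))) =
         (fun h => h^-1 *: ((f \o shift (X + s *: D)) (h *: D) - f (X + s *: D))).
  apply/funext => h /=; congr (_ *: (f _ - _)).
  by rewrite [h *: 1]mulr1 scalerDl addrCA.
have dD : derivable f (X + s *: D) D by exact: diff_derivable.
by apply: DeriveDef; [rewrite /derivable E | rewrite -derive_egrad// /derive E].
Qed.

(** The mean value theorem applied to
[s |-> f (X + s D) - s <grad f X, D> - s^2 (L / 2) |D|^2], whose derivative is
nonpositive for [s >= 0]. Applying it to [f] alone would lose the
factor [1 / 2]. *)
Lemma descent_lemma f (L : R) X Y :
  (forall X, differentiable f X) ->
  (forall X Y, fnorm (egrad f X - egrad f Y) <= L * fnorm (X - Y)) ->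
  f Y <= f X + finner (egrad f X) (Y - X) + L / 2 * fnorm (Y - X) ^+ 2.
Proof.
move=> df hgrad; set D := Y - X.
pose a := finner (egrad f X) D; pose b := L / 2 * fnorm D ^+ 2.
pose g : R -> R := (fun s : R => f (X + s *: D)) - a \*: id - b \*: (id * id).
pose dg (s : R) : R :=
  finner (egrad f (X + s *: D)) D - a *: 1 - b *: (s *: 1 + s *: 1).
have gder (s : R) : is_derive s (1 : R) g (dg s).
  by have := is_derive_line (df (X + s *: D)) => ?; rewrite /g /dg; exact: is_derive_eq.
have gcont : {within `[0, 1], continuous g}.
  by apply: derivable_within_continuous => s _; exact: ex_derive.
have [c] := MVT ltr01 (fun s _ => gder s) gcont.
rewrite in_itv/= subr0 mulr1 => /andP[c0 c1].
rewrite /g /dg !fctE /= scale1r scale0r addr0 [X + D]addrC /D subrK -/D => gE.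
have : finner (egrad f (X + c *: D)) D - a <= L * c * fnorm D ^+ 2.
  rewrite -finnerNl -finnerDl; apply: le_trans (finner_le _ _) _.
  rewrite expr2 mulrA ler_wpM2r ?fnorm_ge0//.
  apply: le_trans (hgrad _ _) _.
  by rewrite [X + _]addrC addrK fnormZ gtr0_norm// mulrA.
move: gE; rewrite /a /b /GRing.scale/=; lra.
Qed.

End DescentLemma.

(** * Tangent spaces of the Stiefel manifold *)

Section StiefelGeometry.
Context (R : realType) (n r : nat).
Implicit Types X Y V W : 'M[R]_(n, r).

Lemma tangent0 X : tangent X 0.
Proof. by rewrite /tangent/= trmx0 mul0mx mulmx0 addr0. Qed.

Lemma tangentD X V W : tangent X V -> tangent X W -> tangent X (V + W).
Proof.
rewrite /tangent/= linearD/= mulmxDl mulmxDr addrACA => -> ->.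
by rewrite addr0.
Qed.

Lemma tangentZ X a V : tangent X V -> tangent X (a *: V).
Proof.
by rewrite /tangent/= linearZ/= -scalemxAl -scalemxAr -scalerDr => ->; rewrite scaler0.
Qed.

Lemma tangent_closed X V :
  (forall e, 0 < e -> exists2 W, tangent X W & fnorm (V - W) < e) -> tangent X V.
Proof.
move=> H; apply: (@eq0_of_fnorm_small _ _ _ _ (2 * fnorm X)) => e e0 _.
have [W XW VW] := H e e0.
have -> : V^T *m X + X^T *m V = (V - W)^T *m X + X^T *m (V - W).
  by rewrite linearB/= mulmxBl mulmxBr addrACA -opprD XW oppr0 addr0.
apply: le_trans (fnormD _ _) _.
have := fnormM (V - W)^T X; have := fnormM X^T (V - W); rewrite !fnorm_tr.
have := ler_wpM2l (fnorm_ge0 X) (ltW VW).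
rewrite [fnorm (V - W) * _]mulrC; lra.
Qed.

Lemma fnorm_Stiefel X : Stiefel X -> fnorm X = Num.sqrt r%:R.
Proof. by move=> XX; rewrite /fnorm /finner XX mxtrace1. Qed.

Lemma Stiefel_closed Y :
  (forall e, 0 < e -> exists2 X, Stiefel X & fnorm (X - Y) < e) -> Stiefel Y.
Proof.
move=> H; apply/eqP; rewrite -subr_eq0; apply/eqP.
apply: (@eq0_of_fnorm_small _ _ _ _ (fnorm Y + Num.sqrt r%:R)) => e e0 _.
have [X XX XY] := H e e0.
have -> : Y^T *m Y - 1%:M = Y^T *m (Y - X) + (Y - X)^T *m X.
  by rewrite [(Y - X)^T]linearB/= mulmxBl mulmxBr XX addrA subrK.
apply: le_trans (fnormD _ _) _.
have := fnormM (Y - X)^T X; have := fnormM Y^T (Y - X).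
rewrite !fnorm_tr (fnorm_Stiefel XX) (fnormC Y X).
have := ler_wpM2l (fnorm_ge0 Y) (ltW XY).
have := ler_wpM2r (sqrtr_ge0 r%:R) (ltW XY).
lra.
Qed.

(** The closed form of the orthogonal projection onto the tangent space at [X],
used to see that projections exist and depend continuously on [X]. *)
Definition stiefel_proj X Y : 'M[R]_(n, r) :=
  Y - X *m (2^-1 *: (X^T *m Y + Y^T *m X)).

Lemma stiefel_proj_tangent X Y : Stiefel X -> tangent X (stiefel_proj X Y).
Proof.
move=> XX; rewrite /tangent/= /stiefel_proj.
set S := 2^-1 *: _.
have ST : S^T = S by rewrite /S linearZ/= linearD/= !trmx_mul !trmxK addrC.
have XSX : (X *m S)^T *m X = S by rewrite trmx_mul ST -mulmxA XX mulmx1.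
have XXS : X^T *m (X *m S) = S by rewrite mulmxA XX mul1mx.
rewrite [(Y - _)^T]linearB/= mulmxBl mulmxBr XSX XXS addrACA -opprD.
rewrite -mulr2n -scaler_nat scalerA.
by rewrite divff ?pnatr_eq0// scale1r [X^T *m Y + _]addrC subrr.
Qed.

(** [Y - stiefel_proj X Y = X S] with [S] symmetric, and [X^T W] is
antisymmetric for tangent [W], so the trace of [S (X^T W)] vanishes. *)
Lemma stiefel_proj_orthogonal X Y W :
  tangent X W -> finner (Y - stiefel_proj X Y) W = 0.
Proof.
move=> XW; rewrite /stiefel_proj; set S := 2^-1 *: _.
have ST : S^T = S by rewrite /S linearZ/= linearD/= !trmx_mul !trmxK addrC.
have XWT : X^T *m W = - (W^T *m X) by apply/eqP; rewrite -addr_eq0 addrC XW.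
rewrite subKr /finner trmx_mul ST -mulmxA.
have : \tr (S *m (X^T *m W)) = - \tr (S *m (X^T *m W)).
  rewrite -[LHS]mxtrace_tr trmx_mul ST trmx_mul trmxK mxtrace_mulC.
  by rewrite -linearN/= -mulmxN XWT opprK.
lra.
Qed.

Lemma tproj_unique X Y P :
  tangent X P -> (forall W, tangent X W -> finner (Y - P) W = 0) ->
  tproj X Y = P.
Proof.
move=> XP YP; apply: xget_unique => [//|Q [XQ YQ]].
have XPQ : tangent X (Q - P).
  by apply: tangentD => //; rewrite -scaleN1r; exact: tangentZ.
apply/eqP; rewrite -subr_eq0; apply/eqP/fnorm_eq0.
have -> : fnorm (Q - P) = Num.sqrt (finner ((Y - P) - (Y - Q)) (Q - P)).
  by rewrite /fnorm; congr (Num.sqrt (finner _ _));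
     rewrite opprB [RHS]addrC addrA subrK.
by rewrite finnerDl finnerNl YP// YQ// subrr sqrtr0.
Qed.

Lemma tprojP X Y : Stiefel X ->
  tangent X (tproj X Y) /\
  (forall W, tangent X W -> finner (Y - tproj X Y) W = 0).
Proof.
move=> XX; rewrite (@tproj_unique X Y (stiefel_proj X Y)).
- by split; [exact: stiefel_proj_tangent | exact: stiefel_proj_orthogonal].
- exact: stiefel_proj_tangent.
- exact: stiefel_proj_orthogonal.
Qed.

(** The correction is [X] times half of [X^T W + W^T X], and this sum vanishes
when [X] is replaced by [Y], so it is of the order of [X - Y]. *)
Lemma stiefel_proj_near X Y W : Stiefel X -> tangent Y W ->
  fnorm (stiefel_proj X W - W) <= Num.sqrt r%:R * fnorm W * fnorm (X - Y).
Proof.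
move=> XX YW.
have -> : stiefel_proj X W - W =
    - (X *m (2^-1 *: ((X - Y)^T *m W + W^T *m (X - Y)))).
  rewrite /stiefel_proj addrAC subrr add0r; congr (- (X *m (_ *: _))).
  rewrite [(X - Y)^T]linearB/= mulmxBl mulmxBr addrACA -opprD.
  by rewrite [Y^T *m W + _]addrC YW oppr0 addr0.
rewrite fnormN; apply: le_trans (fnormM _ _) _.
rewrite fnorm_Stiefel// -mulrA ler_wpM2l ?sqrtr_ge0// fnormZ.
rewrite ger0_norm ?invr_ge0// mulrC ler_pdivrMr//.
have := fnormD ((X - Y)^T *m W) (W^T *m (X - Y)).
have := fnormM (X - Y)^T W; have := fnormM W^T (X - Y); rewrite !fnorm_tr.
by rewrite [fnorm (X - Y) * _]mulrC; lra.
Qed.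

End StiefelGeometry.

(** The tangent space is the kernel of [W |-> W^T X + X^T W]; a [{vspace _}] is
needed to argue by induction on the dimension. *)
Lemma tangent_vspace (R : realType) (n r : nat) (X : 'M[R]_(n, r)) :
  exists U : {vspace 'M[R]_(n, r)}, forall W, W \in U <-> tangent X W.
Proof.
pose d (W : 'M[R]_(n, r)) := W^T *m X + X^T *m W.
have dlin : linear d.
  move=> a V W; rewrite /d linearP/= mulmxDl mulmxDr -scalemxAl -scalemxAr.
  by rewrite scalerDr addrACA.
pose dM := GRing.isLinear.Build _ _ _ _ _ dlin.
pose dL : {linear _ -> _} := HB.pack d dM.
exists (lker (linfun dL)) => W; rewrite memv_ker lfunE /=.
by split=> [/eqP//|XW]; apply/eqP.
Qed.

(** * The tangent space subproblem *)

Section Subproblem.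
Context (R : realType) (n r : nat) (f h : 'M[R]_(n, r) -> R) (L Lh t : R).
Hypothesis t_gt0 : 0 < t.
Hypothesis hconv : convex_function [set: 'M[R]_(n, r)] h.
Hypothesis hLip : forall X Y, `|h X - h Y| <= Lh * fnorm (X - Y).
Implicit Types X Y V W : 'M[R]_(n, r).

Lemma lipschitz_le X Y : h X <= h Y + Lh * fnorm (X - Y).
Proof. by have := le_trans (ler_norm _) (hLip X Y); rewrite lerBlDl. Qed.

Lemma model_lipschitz X V W :
  model f h t X V <= model f h t X W
    + (fnorm (egrad f X) + (2 * t)^-1 * (fnorm V + fnorm W) + Lh) * fnorm (V - W).
Proof.
rewrite /model; have t2 : 0 < (2 * t)^-1 by rewrite invr_gt0 mulr_gt0.
have := lipschitz_le (X + V) (X + W).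
rewrite opprD addrACA subrr add0r => Hh.
have := finner_le (egrad f X) (V - W); rewrite !finner_lin => Hg.
have : fnorm V ^+ 2 - fnorm W ^+ 2 <= (fnorm V + fnorm W) * fnorm (V - W).
  rewrite subr_sqr mulrC ler_wpM2l ?addr_ge0 ?fnorm_ge0//.
  by have := fnormD (V - W) W; rewrite subrK; lra.
move=> /(ler_wpM2l (ltW t2)); rewrite mulrBr; lra.
Qed.

Lemma model_base_lipschitz X Y W :
  fnorm (egrad f X - egrad f Y) <= L * fnorm (X - Y) ->
  model f h t X W <= model f h t Y W + (L * fnorm W + Lh) * fnorm (X - Y).
Proof.
move=> hg; rewrite /model.
have := lipschitz_le (X + W) (Y + W).
rewrite opprD addrACA subrr addr0 => Hh.
have := finner_le (egrad f X - egrad f Y) W; rewrite !finner_lin => Hg.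
have := ler_wpM2r (fnorm_ge0 W) hg; lra.
Qed.

(** Strong convexity of the model at midpoints: convexity of [h] together with
the parallelogram identity for the quadratic term. *)
Lemma model_midpoint X V W :
  model f h t X (2^-1 *: (V + W)) <=
    (model f h t X V + model f h t X W) / 2 - (8 * t)^-1 * fnorm (V - W) ^+ 2.
Proof.
rewrite /model !fnorm_sqr.
have h0 : (0 : R) <= 2^-1 by rewrite invr_ge0.
have h1 : (2^-1 : R) <= 1 by rewrite invf_le1// ler1n.
have := convex_functionE hconv (X + V) (X + W) h0 h1.
have -> : (1 : R) - 2^-1 = 2^-1 by lra.
rewrite -scalerDr addrACA scalerDr -[X + X]mulr2n -[X *+ 2]scaler_nat scalerA.
rewrite mulVf ?pnatr_eq0// scale1r => Hh.
rewrite !finner_lin (finnerC W V).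
have -> : (8 * t)^-1 = (2 * t)^-1 / 4 by field; rewrite gt_eqF.
move: (finner V V) (finner V W) (finner W W) => a b c.
move: ((2 * t)^-1) => k; lra.
Qed.

(** The linear and Lipschitz terms cost at most a multiple [k] of [|W|], and
[|W|^2 / (2 t) - k |W|] is at least [- t k^2 / 2]. *)
Lemma model_ge X W :
  h X - t * (fnorm (egrad f X) + Lh) ^+ 2 / 2 <= model f h t X W.
Proof.
rewrite /model; have t2 : 0 < (2 * t)^-1 by rewrite invr_gt0 mulr_gt0.
have := lipschitz_le X (X + W); rewrite opprD addrA subrr add0r fnormN => Hh.
have := finner_le (egrad f X) (- W); rewrite finnerNr fnormN => Hg.
set k := fnorm (egrad f X) in Hg *.
have : 0 <= (2 * t)^-1 * (fnorm W - t * (k + Lh)) ^+ 2.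
  by rewrite mulr_ge0 ?sqr_ge0 ?ltW.
have -> : (2 * t)^-1 * (fnorm W - t * (k + Lh)) ^+ 2 =
  (2 * t)^-1 * fnorm W ^+ 2 - (k + Lh) * fnorm W + t * (k + Lh) ^+ 2 / 2.
  by field; rewrite gt_eqF.
lra.
Qed.

Lemma model0 X : model f h t X 0 = h X.
Proof. by rewrite /model finner0r fnorm0 expr0n mulr0 !add0r addr0. Qed.

(** The midpoint of two almost optimal vectors cannot beat the infimum, so
[model_midpoint] bounds the square of their distance by their excess over it:
minimizing sequences are Cauchy. *)
Lemma argmin_model_exists X : exists V, argmin_model f h t X V.
Proof.
pose vals := [set model f h t X W | W in tangent X].
have vals0 : vals !=set0 by exists (model f h t X 0); exists 0 => //; exact: tangent0.
have vals_lb : has_lbound vals.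
  exists (h X - t * (fnorm (egrad f X) + Lh) ^+ 2 / 2) => _ [W _ <-].
  exact: model_ge.
have vals_inf : has_inf vals by [].
set m := inf vals.
have m_le W : tangent X W -> m <= model f h t X W.
  by move=> XW; apply: ge_inf => //; exists W.
have approx i : exists W, tangent X W /\ model f h t X W < m + i.+1%:R^-1.
  have [_ [W XW <-] Wm] : exists2 x, vals x & x < m + i.+1%:R^-1.
    by apply: inf_adherent => //; rewrite invr_gt0 ltr0n.
  by exists W.
have [u uP] := choice approx.
have invn_small (e : R) : 0 < e -> exists N, forall i, (N <= i)%N -> i.+1%:R^-1 < e.
  move=> e0; exists (Num.truncn e^-1) => i Ni.
  rewrite -ltf_pV2 ?posrE// ?invr_gt0 ?ltr0n// invrK.
  by apply: lt_le_trans (truncnS_gt _) _; rewrite ler_nat.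
have [|v vP] := @fnorm_complete _ _ _ u.
  move=> e e0; have et0 : 0 < e ^+ 2 / (8 * t) by rewrite divr_gt0 ?exprn_gt0 ?mulr_gt0.
  have [N NP] := invn_small _ et0.
  exists N => i j Ni Nj.
  rewrite -(ltr_pXn2r (n := 2)) ?nnegrE ?fnorm_ge0 ?(ltW e0)//.
  have := NP i Ni; have := NP j Nj; have [ui ui'] := uP i; have [uj uj'] := uP j.
  have := m_le _ (tangentZ 2^-1 (tangentD ui uj)).
  have := model_midpoint X (u i) (u j).
  move=> H1 H2 H3 H4.
  have : (8 * t)^-1 * fnorm (u i - u j) ^+ 2 < e ^+ 2 / (8 * t).
    by move: (i.+1%:R^-1) (j.+1%:R^-1) H3 H4 ui' uj' => *; lra.
  by rewrite mulrC ltr_pM2r// invr_gt0 mulr_gt0.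
have v_near e : 0 < e ->
    exists W, [/\ tangent X W, fnorm (v - W) < e & model f h t X W < m + e].
  move=> e0; have [N1 N1P] := vP e e0; have [N2 N2P] := invn_small e e0.
  have [uT um] := uP (maxn N1 N2); exists (u (maxn N1 N2)); split => //.
    by apply: N1P; rewrite leq_maxl.
  by apply: lt_trans um _; rewrite ltrD2l N2P// leq_maxr.
exists v; split.
  by apply: tangent_closed => e e0; have [W [? ? _]] := v_near e e0; exists W.
move=> W XW; apply: le_trans (m_le W XW).
pose k := (2 * t)^-1.
have k0 : 0 < k by rewrite invr_gt0 mulr_gt0.
pose d := fnorm (egrad f X) + k * (2 * fnorm v + 1) + `|Lh|.
apply: (@le_of_small_error _ _ _ (1 + d)) => e e0 e1.
have [Z [XZ vZ Zm]] := v_near e e0.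
have := model_lipschitz X v Z.
set c := (X in X * _) => H.
have cle : c <= d.
  rewrite /c lerD ?ler_norm// lerD// ler_wpM2l ?(ltW k0)//.
  by have := fnorm_triangle Z 0 v; rewrite !subr0 (fnormC Z v); lra.
have := ler_wpM2r (fnorm_ge0 (v - Z)) cle.
move=> Hd.
have d0 : 0 <= d.
  rewrite /d addr_ge0 ?normr_ge0// addr_ge0 ?fnorm_ge0// mulr_ge0 ?(ltW k0)//.
  by rewrite addr_ge0// mulr_ge0 ?fnorm_ge0.
have := ler_wpM2l d0 (ltW vZ); lra.
Qed.

Lemma argmin_model_unique X V W :
  argmin_model f h t X V -> argmin_model f h t X W -> V = W.
Proof.
move=> [XV minV] [XW minW].
have := model_midpoint X V W.
have := minV _ (tangentZ 2^-1 (tangentD XV XW)); have := minW V XV.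
have k0 : 0 < (8 * t)^-1 by rewrite invr_gt0 mulr_gt0.
move=> H1 H2 H3.
have : (8 * t)^-1 * fnorm (V - W) ^+ 2 <= 0 by lra.
rewrite pmulr_rle0// => H; apply/eqP; rewrite -subr_eq0; apply/eqP/fnorm_eq0.
by apply/eqP; rewrite -sqrf_eq0 eq_le H sqr_ge0.
Qed.

Lemma unique_dir_exists X : exists V, unique_dir f h t X V.
Proof.
have [V minV] := argmin_model_exists X; exists V.
apply/seteqP; split=> [W minW|_ ->//]; exact: argmin_model_unique minW minV.
Qed.

Lemma convex_step X V a : 0 <= a -> a <= 1 ->
  h (X + a *: V) - h X <= a * (h (X + V) - h X).
Proof.
move=> a0 a1; have := convex_functionE hconv (X + V) X a0 a1.
rewrite scalerDr scalerBl scale1r addrC addrA subrK; lra.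
Qed.

(** Compare [V] with [(1 - e) V]: by convexity of [h] the difference of the model
values is at least [e] times
[<grad f X, V> + h (X + V) - h X + (2 - e) |V|^2 / (2 t)], and [e] tends
to [0]. *)
Lemma argmin_model_decrease X V : argmin_model f h t X V ->
  finner (egrad f X) V + h (X + V) - h X <= - (fnorm V ^+ 2 / t).
Proof.
move=> [XV minV].
have k0 : 0 < (2 * t)^-1 by rewrite invr_gt0 mulr_gt0.
apply: (@le_of_small_error _ _ _ ((2 * t)^-1 * fnorm V ^+ 2)) => e e0 e1.
have := minV _ (tangentZ (1 - e) XV).
rewrite /model finnerZr fnormZ exprMn real_normK ?num_real//.
have := @convex_step X V (1 - e).
rewrite subr_ge0 e1 gerBl (ltW e0) => /(_ isT isT) H1 H2.
have -> : fnorm V ^+ 2 / t = 2 * ((2 * t)^-1 * fnorm V ^+ 2).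
  by field; rewrite gt_eqF.
rewrite -subr_ge0 -(pmulr_rge0 _ e0); move: H1 H2.
move: (_^-1) (fnorm V ^+ 2) (finner _ _) (h _) (h _) (h _) => k q a b c d.
lra.
Qed.

End Subproblem.

(** * Points where the zero vector solves the subproblem *)

Section Limit.
Context (R : realType) (n r : nat) (f h : 'M[R]_(n, r) -> R) (L Lh t G : R).
Hypothesis t_gt0 : 0 < t.
Hypothesis L_gt0 : 0 < L.
Hypothesis Lh_ge0 : 0 <= Lh.
Hypothesis hgrad :
  forall X Y, fnorm (egrad f X - egrad f Y) <= L * fnorm (X - Y).
Hypothesis hgradG : forall X, Stiefel X -> fnorm (egrad f X) <= G.
Hypothesis hconv : convex_function [set: 'M[R]_(n, r)] h.
Hypothesis hLip : forall X Y, `|h X - h Y| <= Lh * fnorm (X - Y).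
Implicit Types X Y V W : 'M[R]_(n, r).

(** For [W] tangent at [Y], the projection of [W] to the tangent space at [X] is a
competitor of [V] at [X] and is close to [W]. Both model values move little when
[X] is replaced by [Y], and [V] is close to [0]. *)
Lemma argmin_model_limit Y :
  (forall e, 0 < e -> exists X V, [/\ Stiefel X, argmin_model f h t X V,
     fnorm (X - Y) < e & fnorm V < e]) ->
  Stiefel Y /\ argmin_model f h t Y 0.
Proof.
move=> near_Y.
have YS : Stiefel Y.
  apply: Stiefel_closed => e e0.
  by have [X [V [XS _ XY _]]] := near_Y e e0; exists X.
have G0 : 0 <= G by exact: le_trans (fnorm_ge0 _) (hgradG YS).
split=> //; split=> [|W YW]; first exact: tangent0.
pose k := (2 * t)^-1; pose w := fnorm W; pose s := Num.sqrt (r%:R : R) * w.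
have k0 : 0 <= k by rewrite invr_ge0 mulr_ge0 ?ltW.
have w0 : 0 <= w by exact: fnorm_ge0.
have s0 : 0 <= s by rewrite mulr_ge0 ?sqrtr_ge0.
(* The four terms bound the costs of replacing 0 by V at Y, of moving V from Y
   to X, of replacing the projection of W by W at X, and of moving W from X
   to Y. *)
apply: (@le_of_small_error _ _ _ ((G + k + Lh) + (L + Lh) +
   (G + k * (2 * w + s) + Lh) * s + (L * w + Lh))) => e e0 e1.
have [X [V [XS [XV minV] XY Ve]]] := near_Y e e0.
have V0 := fnorm_ge0 V; have XY0 := fnorm_ge0 (X - Y).
have W'W := stiefel_proj_near XS YW; set W' := stiefel_proj X W in W'W.
have se : fnorm (W' - W) <= s * e.
  by apply: le_trans W'W _; rewrite ler_wpM2l// ltW.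
have W'le : fnorm W' <= w + s.
  have := fnormD (W' - W) W; rewrite subrK -/w.
  by have := ler_wpM2l s0 e1; lra.
have H1 := model_lipschitz f t_gt0 hLip Y 0 V.
rewrite fnorm0 add0r sub0r fnormN in H1.
have H1' : (fnorm (egrad f Y) + k * fnorm V + Lh) * fnorm V <= (G + k + Lh) * e.
  apply: ler_pM; rewrite ?addr_ge0 ?mulr_ge0 ?fnorm_ge0 ?(ltW Ve)//.
  by rewrite lerD2r lerD ?hgradG// ler_piMr// (le_trans (ltW Ve)).
have H2 := model_base_lipschitz t hLip V (hgrad Y X).
have H2' : (L * fnorm V + Lh) * fnorm (Y - X) <= (L + Lh) * e.
  rewrite fnormC; apply: ler_pM; rewrite ?addr_ge0 ?mulr_ge0 ?(ltW L_gt0) ?(ltW XY)//.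
  by rewrite lerD2r ler_piMr ?(ltW L_gt0)// (le_trans (ltW Ve)).
have H3 := minV _ (stiefel_proj_tangent W XS).
have H4 := model_lipschitz f t_gt0 hLip X W' W.
have H4' : (fnorm (egrad f X) + k * (fnorm W' + w) + Lh) * fnorm (W' - W) <=
    (G + k * (2 * w + s) + Lh) * (s * e).
  apply: ler_pM; rewrite ?addr_ge0 ?mulr_ge0 ?addr_ge0 ?fnorm_ge0//.
  by rewrite lerD2r lerD ?hgradG// ler_wpM2l//; lra.
have H5 := model_base_lipschitz t hLip W (hgrad X Y).
have H5' : (L * w + Lh) * fnorm (X - Y) <= (L * w + Lh) * e.
  by rewrite ler_wpM2l ?(ltW XY)// addr_ge0 ?mulr_ge0 ?(ltW L_gt0).
rewrite -/k in H1 H4; rewrite -/w in H4 H5; rewrite -/W' in H3.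
rewrite mulrDl mulrDl mulrDl -[_ * s * e]mulrA.
apply: le_trans H1 _; apply: le_trans (lerD (lexx _) H1') _.
apply: le_trans (lerD H2 (lexx _)) _.
apply: le_trans (lerD (lerD H3 H2') (lexx _)) _.
apply: le_trans (lerD (lerD H4 (lexx _)) (lexx _)) _.
apply: le_trans (lerD (lerD (lerD H5 H4') (lexx _)) (lexx _)) _.
move: H5' ((L + Lh) * e) ((G + k + Lh) * e) (_ * (s * e)) => H5' x y z.
by lra.
Qed.

(** First-order optimality at [0]: compare with [e W]; the quadratic term is of
order [e^2] and convexity compares [h (Y + e W)] with [h (Y + W)]. *)
Lemma argmin_model0_variational Y W : argmin_model f h t Y 0 -> tangent Y W ->
  - finner (egrad f Y) W <= h (Y + W) - h Y.
Proof.
move=> [_ min0] YW.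
apply: (@le_of_small_error _ _ _ ((2 * t)^-1 * fnorm W ^+ 2)) => e e0 e1.
have := min0 _ (tangentZ e YW); rewrite model0 /model finnerZr fnormZ gtr0_norm//.
have := convex_step hconv Y W (ltW e0) e1.
rewrite -subr_ge0 => H1 H2; rewrite -subr_ge0 -(pmulr_rge0 _ e0).
move: H1 H2.
move: (_^-1) (fnorm W) (finner _ _) (h _) (h _) (h _) => k q a b c d.
lra.
Qed.

(** The variational inequality bounds [- egrad f Y] by [h (Y + .) - h Y] on the
tangent space only. Its Hahn-Banach extension is a subgradient of [h] at [Y]
whose tangential projection is [- rgrad f Y]. *)
Lemma stationary_of_argmin0 Y :
  Stiefel Y -> argmin_model f h t Y 0 -> stationary f h Y.
Proof.
move=> YS min0; split=> //.
have [U UP] := tangent_vspace Y.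
pose phi W := h (Y + W) - h Y.
have phi_convex s A B : 0 <= s -> s <= 1 ->
    phi (s *: A + (1 - s) *: B) <= s * phi A + (1 - s) * phi B.
  move=> s0 s1; have := convex_functionE hconv (Y + A) (Y + B) s0 s1.
  have -> : s *: (Y + A) + (1 - s) *: (Y + B) = Y + (s *: A + (1 - s) *: B).
    by rewrite !scalerDr addrACA -scalerDl addrC subrKC scale1r addrC.
  rewrite /phi; lra.
have [|D [DU Dphi]] := @hahn_banach _ _ _ _ phi_convex U (- egrad f Y).
  by move=> u /UP Yu; rewrite finnerNl; exact: argmin_model0_variational.
have [rT rP] := tprojP (egrad f Y) YS.
exists (tproj Y D).
  exists D => // Z; have := Dphi (Z - Y); rewrite /phi subrKC; lra.
rewrite (@tproj_unique _ _ _ Y D (- rgrad f Y)) ?subrr//.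
  by rewrite -scaleN1r; exact: tangentZ.
move=> W YW; rewrite opprK finnerDl DU; last exact/UP.
by have := rP W YW; rewrite !finner_lin /rgrad; lra.
Qed.

End Limit.

(** * Backtracking and decreasing sequences *)

Lemma backtracking_stops (R : realType) (P : R -> Prop) (gamma abar : R) :
  0 < gamma -> gamma < 1 -> 0 < abar ->
  (forall a, 0 <= a -> a <= 1 -> a <= abar -> P a) ->
  exists m, P (gamma ^+ m) /\ forall j, (j < m)%N -> ~ P (gamma ^+ j).
Proof.
move=> g0 g1 abar0 HP.
have [N gN] : exists N, gamma ^+ N <= abar.
  have : (fun N => gamma ^+ N : R) @ \oo --> (0 : R).
    by apply: cvg_expr; rewrite gtr0_norm.
  move=> /cvgrPdist_lt/(_ abar abar0)[N _ /(_ N (leqnn N))/=].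
  by rewrite sub0r normrN gtr0_norm ?exprn_gt0// => /ltW; exists N.
have exP : exists m, `[< P (gamma ^+ m) >].
  exists N; apply/asboolP; apply: HP => //; first by rewrite exprn_ge0 ?ltW.
  by rewrite exprn_ile1 ?ltW.
exists (ex_minn exP); case: ex_minnP => m /asboolP Pm mmin; split=> // j jm Pj.
by have := mmin j; rewrite leqNgt jm => H; have := H (asboolT Pj).
Qed.

(** If the step was reduced at all, the previous trial exceeded [abar], as it
was rejected. *)
Lemma backtracking_step_ge (R : realType) (P : R -> Prop) (gamma abar : R) m :
  0 < gamma -> gamma < 1 ->
  (forall a, 0 <= a -> a <= 1 -> a <= abar -> P a) ->
  (forall j, (j < m)%N -> ~ P (gamma ^+ j)) ->
  Num.min 1 (gamma * abar) <= gamma ^+ m.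
Proof.
move=> g0 g1 HP; case: m => [_|m mP]; first by rewrite ge_min lexx.
rewrite ge_min exprS ler_pM2l//; apply/orP; right.
rewrite leNgt; apply/negP => lt_abar; apply: (mP m (ltnSn m)).
by apply: HP; rewrite ?(ltW lt_abar) ?exprn_ge0 ?exprn_ile1 ?ltW.
Qed.

(** Once the sequence is within [eta] of its infimum, it cannot drop by [eta]. *)
Lemma decrements_vanish (R : realType) (a : nat -> R) (B : R) :
  (forall k, a k.+1 <= a k) -> (forall k, B <= a k) ->
  forall eta, 0 < eta -> exists N, forall k, (N <= k)%N -> a k - a k.+1 < eta.
Proof.
move=> adec aB eta eta0.
have infa : has_inf (range a).
  by split; [exists (a 0%N), 0%N | exists B => _ [k _ <-]].
have [_ [N _ <-] aN] := inf_adherent eta0 infa.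
exists N => k Nk.
have : a k <= a N.
  by apply: (nonincreasing_seqP _).1 Nk.
have : inf (range a) <= a k.+1.
  by apply: ge_inf; [exact: infa.2 | exists k.+1].
lra.
Qed.

Lemma telescope_bound (R : realType) (a : nat -> R) (d : R) K :
  (forall k, (k < K)%N -> a k.+1 <= a k - d) -> a K <= a 0%N - K%:R * d.
Proof.
elim: K => [|K IH] H; first by rewrite mul0r subr0.
have := H K (ltnSn K); have := IH (fun k kK => H k (ltnW kK)).
rewrite -[K.+1%:R]natr1; lra.
Qed.

(** * One iteration of the algorithm *)

Section Step.
Context (R : realType) (n r : nat) (f h : 'M[R]_(n, r) -> R).
Context (Retr : 'M[R]_(n, r) -> 'M[R]_(n, r) -> 'M[R]_(n, r)).
Context (L Lh M1 M2 G t : R).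
Hypothesis L_gt0 : 0 < L.
Hypothesis Lh_ge0 : 0 <= Lh.
Hypothesis M1_gt0 : 0 < M1.
Hypothesis M2_gt0 : 0 < M2.
Hypothesis G_gt0 : 0 < G.
Hypothesis t_gt0 : 0 < t.
Hypothesis hf : forall X, differentiable f X.
Hypothesis hgrad :
  forall X Y, fnorm (egrad f X - egrad f Y) <= L * fnorm (X - Y).
Hypothesis hconv : convex_function [set: 'M[R]_(n, r)] h.
Hypothesis hLip : forall X Y, `|h X - h Y| <= Lh * fnorm (X - Y).
Hypothesis hRetr1 : forall X xi, Stiefel X -> tangent X xi ->
  fnorm (Retr X xi - X) <= M1 * fnorm xi.
Hypothesis hRetr2 : forall X xi, Stiefel X -> tangent X xi ->
  fnorm (Retr X xi - (X + xi)) <= M2 * fnorm xi ^+ 2.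
Hypothesis hgradG : forall X, Stiefel X -> fnorm (egrad f X) <= G.
Implicit Types X Y V W : 'M[R]_(n, r).

(** The Stiefel manifold is bounded, so the descent lemma from [X] to [X0] and the
Lipschitz bound for [h] control [f + h] from below without compactness. *)
Lemma objective_lower_bound X0 : Stiefel X0 ->
  exists B, forall X, Stiefel X -> B <= f X + h X.
Proof.
move=> X0S; pose d : R := 2 * Num.sqrt r%:R.
exists (f X0 + h X0 - G * d - L / 2 * d ^+ 2 - Lh * d) => X XS.
have Xd : fnorm (X0 - X) <= d.
  by apply: le_trans (fnormD _ _) _; rewrite fnormN !fnorm_Stiefel// /d mulr_natl.
have d0 : 0 <= d by exact: le_trans (fnorm_ge0 _) Xd.
have := descent_lemma X X0 hf hgrad.
have := lipschitz_le hLip X0 X.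
have := ler_wpM2l Lh_ge0 Xd.
have : finner (egrad f X) (X0 - X) <= G * d.
  by apply: le_trans (finner_le _ _) _; apply: ler_pM; rewrite ?fnorm_ge0 ?hgradG.
have : L / 2 * fnorm (X0 - X) ^+ 2 <= L / 2 * d ^+ 2.
  by rewrite ler_pM2l ?divr_gt0// lerXn2r ?nnegrE ?fnorm_ge0.
lra.
Qed.

(** [Retr X (e V) - X] is [e V] up to a term of order [e^2], so for small [e] its
norm cannot be at most [M1 e |V|] with [M1 < 1]. *)
Lemma retraction_constant_ge1 X V :
  Stiefel X -> tangent X V -> 0 < fnorm V -> 1 <= M1.
Proof.
move=> XS XV V0; apply: (@le_of_small_error _ _ _ (M2 * fnorm V)) => e e0 _.
have XeV := tangentZ e XV.
have := fnorm_triangle (X + e *: V) X (Retr X (e *: V)).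
rewrite (fnormC _ (Retr X (e *: V))) [X + e *: V - X]addrC addKr.
have := hRetr1 XS XeV; have := hRetr2 XS XeV.
rewrite fnormZ gtr0_norm// => H1 H2 H3.
have eV : 0 < e * fnorm V by rewrite mulr_gt0.
rewrite -(ler_pM2r eV).
move: (fnorm V) H1 H2 H3 => v; lra.
Qed.

Let c := M2 * G + L * M1 ^+ 2 / 2 + Lh * M2.
Let abar := (2 * c * t)^-1.

Lemma decrease_const_gt0 : 0 < c.
Proof.
by rewrite /c ltr_pwDl ?mulr_ge0 ?(ltW M2_gt0)// ltr_wpDr ?mulr_gt0//
   divr_ge0// mulr_ge0 ?sqr_ge0// ltW.
Qed.

(** To first order the objective changes by [a] times the left side of
[argmin_model_decrease], hence by at most [- a |V|^2 / t]. The second-order error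
[c a^2 |V|^2] uses up at most half of this gain when [2 c t a <= 1]. *)
Lemma sufficient_decrease X V a :
  Stiefel X -> argmin_model f h t X V -> 0 <= a -> a <= 1 -> a <= abar ->
  accept f h Retr t X V a.
Proof.
move=> XS minV a0 a1 a_abar; have [XV _] := minV.
rewrite /accept; set Y := Retr X (a *: V).
have XaV := tangentZ a XV.
have := hRetr1 XS XaV; have := hRetr2 XS XaV; rewrite -/Y.
rewrite fnormZ ger0_norm// => Y2 Y1.
have v0 := fnorm_ge0 V.
(* The quadratic coefficient collects the retraction error seen by the gradient
   and the curvature term of the descent lemma. *)
have smooth : f Y <= f X + a * finner (egrad f X) V
    + (M2 * G + L * M1 ^+ 2 / 2) * (a * fnorm V) ^+ 2.
  apply: le_trans (descent_lemma X Y hf hgrad) _.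
  have : finner (egrad f X) (Y - (X + a *: V)) <= G * (M2 * (a * fnorm V) ^+ 2).
    apply: le_trans (finner_le _ _) _; apply: ler_pM; rewrite ?fnorm_ge0//.
    exact: hgradG.
  have : L / 2 * fnorm (Y - X) ^+ 2 <= L / 2 * (M1 * (a * fnorm V)) ^+ 2.
    rewrite ler_pM2l ?divr_gt0// lerXn2r ?nnegrE ?fnorm_ge0//.
    by rewrite !mulr_ge0// ltW.
  by rewrite !finner_lin; move: (fnorm V) (finner _ _) (finner _ _) => v p q; lra.
have nonsmooth : h Y <= h X + a * (h (X + V) - h X) + Lh * M2 * (a * fnorm V) ^+ 2.
  have := lipschitz_le hLip Y (X + a *: V).
  have := ler_wpM2l Lh_ge0 Y2.
  have := convex_step hconv X V a0 a1; lra.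
have := ler_wpM2l a0 (argmin_model_decrease t_gt0 hconv minV).
have : c * (a * fnorm V) ^+ 2 <= a * fnorm V ^+ 2 / (2 * t).
  have -> : c * (a * fnorm V) ^+ 2 = (c * a) * (a * fnorm V ^+ 2) by ring.
  rewrite [leRHS]mulrC ler_wpM2r ?mulr_ge0 ?sqr_ge0//.
  rewrite mulrC -ler_pdivlMr ?decrease_const_gt0//.
  apply: le_trans a_abar _; rewrite /abar le_eqVlt; apply/orP; left; apply/eqP.
  by field; rewrite !gt_eqF ?decrease_const_gt0.
have -> : a * - (fnorm V ^+ 2 / t) = - 2 * (a * fnorm V ^+ 2 / (2 * t)).
  by field; rewrite gt_eqF.
rewrite /c; lra.
Qed.

Lemma ManPG_step_exists (gamma : R) X : 0 < gamma -> gamma < 1 -> Stiefel X ->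
  exists V X', ManPG_step f h Retr gamma t X V X'.
Proof.
move=> g0 g1 XS; have [V uV] := unique_dir_exists f t_gt0 hconv hLip X.
have minV : argmin_model f h t X V by rewrite uV.
have abar0 : 0 < abar by rewrite invr_gt0 !mulr_gt0 ?decrease_const_gt0.
have [m [mP mmin]] := backtracking_stops g0 g1 abar0
  (fun a => @sufficient_decrease X V a XS minV).
by exists V, (Retr X (gamma ^+ m *: V)); split=> //; exists m.
Qed.

Lemma ManPG_step_decrease (gamma : R) X V X' : 0 < gamma -> gamma < 1 ->
  Stiefel X -> ManPG_step f h Retr gamma t X V X' ->
  f X' + h X' <=
    f X + h X - Num.min 1 (gamma * abar) * fnorm V ^+ 2 / (2 * t).
Proof.
move=> g0 g1 XS [uV [m [+ mmin ->]]].
have minV : argmin_model f h t X V by rewrite uV.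
have := backtracking_step_ge g0 g1
  (fun a => @sufficient_decrease X V a XS minV) mmin.
rewrite /accept => H /le_trans; apply; rewrite lerD2l lerN2.
by rewrite ler_pM2r ?invr_gt0 ?mulr_gt0// ler_wpM2r ?sqr_ge0.
Qed.

End Step.

Lemma ManPG_step_Stiefel (R : realType) (n r : nat) (f h : 'M[R]_(n, r) -> R)
    Retr (gamma t : R) X V X' :
  (forall X xi, Stiefel X -> tangent X xi -> Stiefel (Retr X xi)) ->
  Stiefel X -> ManPG_step f h Retr gamma t X V X' -> Stiefel X'.
Proof.
move=> RS XS [uV [m [_ _ ->]]]; apply: RS => //; apply: tangentZ.
have : argmin_model f h t X V by rewrite uV.
by case.
Qed.

(** * Convergence and complexity *)

Lemma cluster_fnorm (R : realType) (n r : nat) (X : nat -> 'M[R]_(n, r)) Y :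
  cluster (X @ \oo) Y ->
  forall e N, 0 < e -> exists2 k, (N <= k)%N & fnorm (X k - Y) < e.
Proof.
move=> clY e N e0; pose c : R := Num.sqrt (n * r)%:R + 1.
have c0 : 0 < c by rewrite ltr_pwDr ?sqrtr_ge0.
have [||_ [[k Nk <-] Yk]] := clY [set X k | k in [set k | (N <= k)%N]]
    (ball Y (e / c)).
- by exists N => // k Nk; exists k.
- by apply: nbhsx_ballx; rewrite divr_gt0.
exists k => //; rewrite fnormC; apply: le_lt_trans (le_fnorm_mx_norm _) _.
move: Yk; rewrite -ball_normE/= ltr_pdivlMr// mulrC; apply: le_lt_trans.
by rewrite ler_wpM2r// lerDl.
Qed.

Section Convergence.
Context (R : realType) (n r : nat) (f h : 'M[R]_(n, r) -> R).
Context (Retr : 'M[R]_(n, r) -> 'M[R]_(n, r) -> 'M[R]_(n, r)).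
Context (L Lh M1 M2 G gamma : R) (X0 : 'M[R]_(n, r)).
Hypothesis L_gt0 : 0 < L.
Hypothesis M1_gt0 : 0 < M1.
Hypothesis M2_gt0 : 0 < M2.
Hypothesis G_gt0 : 0 < G.
Hypothesis hf : forall X, differentiable f X.
Hypothesis hgrad :
  forall X Y, fnorm (egrad f X - egrad f Y) <= L * fnorm (X - Y).
Hypothesis hconv : convex_function [set: 'M[R]_(n, r)] h.
Hypothesis hLip : forall X Y, `|h X - h Y| <= Lh * fnorm (X - Y).
Hypothesis hRetr0 :
  forall X xi, Stiefel X -> tangent X xi -> Stiefel (Retr X xi).
Hypothesis hRetr1 : forall X xi, Stiefel X -> tangent X xi ->
  fnorm (Retr X xi - X) <= M1 * fnorm xi.
Hypothesis hRetr2 : forall X xi, Stiefel X -> tangent X xi ->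
  fnorm (Retr X xi - (X + xi)) <= M2 * fnorm xi ^+ 2.
Hypothesis hgradG : forall X, Stiefel X -> fnorm (egrad f X) <= G.
Hypothesis hX0 : Stiefel X0.
Hypothesis gamma_gt0 : 0 < gamma.
Hypothesis gamma_lt1 : gamma < 1.

(** The decrements of [F] dominate a fixed multiple of [|V k|^2] and vanish, so
arbitrarily late iterates close to [Y] have small [V k]. *)
Lemma limit_point_stationary t X Y : 0 < t ->
  ManPG_seq f h Retr gamma t X0 X -> cluster (X @ \oo) Y -> stationary f h Y.
Proof.
move=> t0 [XX0 [V step]] clY.
(* A negative constant Lh can only occur for one-point matrix spaces; enlarging
   it to 0 preserves the Lipschitz bound. *)
pose Lh' := Num.max Lh 0.
have Lh'0 : 0 <= Lh' by rewrite le_max lexx orbT.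
have hLip' X1 X2 : `|h X1 - h X2| <= Lh' * fnorm (X1 - X2).
  apply: le_trans (hLip _ _) _.
  by rewrite ler_wpM2r ?fnorm_ge0// le_max lexx.
have XS k : Stiefel (X k).
  elim: k => [|k IH]; first by rewrite XX0.
  exact: ManPG_step_Stiefel hRetr0 IH (step k).
pose q := Num.min 1
  (gamma * (2 * (M2 * G + L * M1 ^+ 2 / 2 + Lh' * M2) * t)^-1).
have q0 : 0 < q.
  rewrite lt_min ltr01 mulr_gt0// invr_gt0 !mulr_gt0//.
  exact: decrease_const_gt0.
have drop k : q * fnorm (V k) ^+ 2 / (2 * t) <=
    (f (X k) + h (X k)) - (f (X k.+1) + h (X k.+1)).
  have := ManPG_step_decrease L_gt0 Lh'0 M1_gt0 M2_gt0 G_gt0 t0 hf hgrad hconv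
    hLip' hRetr1 hRetr2 hgradG gamma_gt0 gamma_lt1 (XS k) (step k).
  by rewrite -/q; lra.
have [B FB] := objective_lower_bound L_gt0 Lh'0 hf hgrad hLip' hgradG hX0.
have [|YS min0] := @argmin_model_limit _ _ _ f h L Lh' t G t0 L_gt0 Lh'0 hgrad
    hgradG hLip' Y.
  move=> e e0; pose eta := q * e ^+ 2 / (2 * t).
  have eta0 : 0 < eta by rewrite divr_gt0 ?mulr_gt0 ?exprn_gt0.
  have [|N NP] := @decrements_vanish _ (fun k => f (X k) + h (X k)) B _
    (fun k => FB _ (XS k)) eta eta0.
    move=> k; rewrite -subr_ge0; apply: le_trans (drop k).
    by rewrite divr_ge0 ?mulr_ge0 ?exprn_ge0 ?fnorm_ge0 ?(ltW q0) ?(ltW t0).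
  have [k Nk kY] := cluster_fnorm clY N e0.
  exists (X k), (V k); split=> //; first by have [-> _] := step k.
  have := le_lt_trans (drop k) (NP k Nk).
  rewrite ltr_pM2r ?invr_gt0 ?mulr_gt0// ltr_pM2l//.
  by rewrite ltr_pXn2r// nnegrE ?fnorm_ge0 ?ltW.
exact: stationary_of_argmin0 hconv _ YS min0.
Qed.

Let t := L^-1.
Let c0 := M2 * G + L * M1 ^+ 2 / 2.
Let abar := (2 * (c0 + Lh * M2) * t)^-1.
Let Fstar := inf [set f X + h X | X in @Stiefel R n r].

Lemma ManPG_run_exists : 0 <= Lh ->
  exists X V : nat -> 'M[R]_(n, r), X 0%N = X0 /\
    forall k, Stiefel (X k) /\ ManPG_step f h Retr gamma t (X k) (V k) (X k.+1).
Proof.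
move=> Lh0; have t0 : 0 < t by rewrite invr_gt0.
have exists_step X : exists p : 'M[R]_(n, r) * 'M[R]_(n, r),
    Stiefel X -> ManPG_step f h Retr gamma t X p.1 p.2.
  have [XS|XnS] := pselect (Stiefel X); last by exists (0, 0).
  have [V [X' VX']] := ManPG_step_exists L_gt0 Lh0 M1_gt0 M2_gt0 G_gt0 t0 hf
    hgrad hconv hLip hRetr1 hRetr2 hgradG gamma_gt0 gamma_lt1 XS.
  by exists (V, X').
have [next nextP] := choice exists_step.
pose X k := iter k (fun Z => (next Z).2) X0.
have XS k : Stiefel (X k).
  elim: k => // k IH; exact: ManPG_step_Stiefel hRetr0 IH (nextP _ IH).
by exists X, (fun k => (next (X k)).1); split=> // k; split; last exact: nextP.
Qed.

(** A negative Lipschitz constant forces all matrices to be equal. The run stops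
at once, and the bound is [0] as [X0] is the only point of the manifold. *)
Lemma complexity_degenerate eps : 0 < eps -> Lh < 0 ->
  exists K Y,
    [/\ ManPG_returns f h Retr gamma t (eps / L) X0 K Y,
        K%:Z <= Num.ceil (2 * L * (f X0 + h X0 - Fstar) /
                          (gamma * abar * eps ^+ 2)) &
        eps_stationary f h L eps Y].
Proof.
move=> eps0 Lh0.
have all_eq X Y : X = Y :> 'M[R]_(n, r).
  apply/eqP; rewrite -subr_eq0; apply/eqP/fnorm_eq0/eqP.
  rewrite eq_le fnorm_ge0 andbT.
  by have := le_trans (normr_ge0 _) (hLip X Y); rewrite nmulr_rge0.
have dir0 : unique_dir f h t X0 0.
  apply/seteqP; split=> [V _|V _]; first exact: all_eq.
  by split=> [|W _]; [rewrite (all_eq V 0); exact: tangent0 | rewrite (all_eq V W)].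
have tol0 : fnorm (0 : 'M[R]_(n, r)) <= eps / L by rewrite fnorm0 ltW// divr_gt0.
exists 0%N, X0; split; last by split=> //; exists 0.
- by exists (cst X0), (cst 0); split.
- have -> : Fstar = f X0 + h X0.
    rewrite /Fstar; have -> : [set f X + h X | X in @Stiefel R n r] = [set f X0 + h X0].
      apply/seteqP; split=> [_ [X _ <-]|_ ->]; last by exists X0.
      by rewrite (all_eq X X0).
    by rewrite inf1.
  by rewrite subrr mulr0 mul0r ceil0.
Qed.

(** Before the stopping test succeeds, each step decreases [F] by at least the
constant [d] below, and [K d <= F X0 - Fstar] is the announced bound. The same
estimate shows that the test eventually succeeds. *)
Lemma complexity_bound eps : 0 < eps ->
  exists K Y,
    [/\ ManPG_returns f h Retr gamma t (eps / L) X0 K Y,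
        K%:Z <= Num.ceil (2 * L * (f X0 + h X0 - Fstar) /
                          (gamma * abar * eps ^+ 2)) &
        eps_stationary f h L eps Y].
Proof.
move=> eps0; have [Lh0|Lh0] := ltP Lh 0; first exact: complexity_degenerate.
have t0 : 0 < t by rewrite invr_gt0.
have c_gt0 : 0 < c0 + Lh * M2 by exact: decrease_const_gt0.
have abar0 : 0 < abar by rewrite invr_gt0 !mulr_gt0.
have [X [V [X_0 run]]] := ManPG_run_exists Lh0.
have XS k : Stiefel (X k) := (run k).1.
have step k : ManPG_step f h Retr gamma t (X k) (V k) (X k.+1) := (run k).2.
have FstarP K : Fstar <= f (X K) + h (X K).
  have [B FB] := objective_lower_bound L_gt0 Lh0 hf hgrad hLip hgradG hX0.
  by apply: ge_inf; [exists B => _ [Z ZS <-]; exact: FB | exists (X K)].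
have tol_gt0 : 0 < eps / L by rewrite divr_gt0.
set b := 2 * L * _ / _.
have K_le_b K : (forall k, (k < K)%N -> eps / L < fnorm (V k)) -> K%:R <= b.
  move=> KV; pose d := gamma * abar * eps ^+ 2 / (2 * L).
  have d0 : 0 < d by rewrite divr_gt0 ?mulr_gt0 ?exprn_gt0.
  have drop k : (k < K)%N ->
      f (X k.+1) + h (X k.+1) <= f (X k) + h (X k) - d.
    move=> kK; have Vk := KV k kK.
    have VT : tangent (X k) (V k).
      have : argmin_model f h t (X k) (V k) by have [-> _] := step k.
      by case.
    have Vk0 : 0 < fnorm (V k) by exact: lt_trans tol_gt0 Vk.
    have M1_ge1 := retraction_constant_ge1 hRetr1 hRetr2 (XS k) VT Vk0.
    have abar1 : abar <= 1.
      rewrite invf_le1 ?mulr_gt0// /t ler_pdivlMr// mul1r /c0.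
      have : L <= L * M1 ^+ 2 by rewrite ler_pMr// exprn_ege1.
      have := mulr_gt0 M2_gt0 G_gt0.
      by have := mulr_ge0 Lh0 (ltW M2_gt0); lra.
    have := ManPG_step_decrease L_gt0 Lh0 M1_gt0 M2_gt0 G_gt0 t0 hf hgrad hconv
      hLip hRetr1 hRetr2 hgradG gamma_gt0 gamma_lt1 (XS k) (step k).
    rewrite min_r; last first.
      by rewrite mulr_ile1 ?(ltW gamma_gt0) ?(ltW abar0) ?(ltW gamma_lt1).
    move=> /le_trans; apply; rewrite lerD2l lerN2.
    have -> : d = gamma * abar * (eps / L) ^+ 2 / (2 * t).
      by rewrite /d /t; field; rewrite gt_eqF.
    rewrite ler_pM2r ?invr_gt0 ?mulr_gt0// ler_pM2l ?mulr_gt0//.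
    by rewrite lerXn2r ?nnegrE ?fnorm_ge0 ?ltW.
  have := telescope_bound drop; have := FstarP K; rewrite X_0 => H1 H2.
  have -> : b = (f X0 + h X0 - Fstar) / d.
    by rewrite /b /d; field; rewrite !gt_eqF.
  by rewrite ler_pdivlMr//; lra.
have exK : exists k, fnorm (V k) <= eps / L.
  apply: contrapT => /forallNP noK.
  have : (Num.truncn b).+1%:R <= b.
    by apply: K_le_b => k _; rewrite ltNge; apply/negP/noK.
  by rewrite leNgt truncnS_gt.
exists (ex_minn exK), (X (ex_minn exK)); case: ex_minnP => K VK Kmin.
have before k : (k < K)%N -> eps / L < fnorm (V k).
  by move=> kK; rewrite ltNge; apply/negP => /Kmin; rewrite leqNgt kK.
have dirK : unique_dir f h t (X K) (V K) by have [] := step K.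
split; last by split=> //; exists (V K).
- by exists X, V; split=> // k kK; split=> //; exact: before.
- rewrite -(ler_int R); apply: le_trans (ceil_ge b); exact: K_le_b.
Qed.

End Convergence.

Unset Implicit Arguments.

Theorem theorem5p5 (R : realType) (n r : nat) (hrn : (r <= n)%N)
  (f h : 'M[R]_(n, r) -> R) (L Lh : R)
  (hL : 0 < L)
  (hf : forall X, differentiable f X)
  (hgrad : forall X Y, fnorm (egrad f X - egrad f Y) <= L * fnorm (X - Y))
  (hconv : convex_function [set: 'M[R]_(n, r)] h)
  (hLip : forall X Y, `|h X - h Y| <= Lh * fnorm (X - Y))
  (Retr : 'M[R]_(n, r) -> 'M[R]_(n, r) -> 'M[R]_(n, r))
  (hRetr : retraction Retr)
  (M1 M2 G : R) (hM1 : 0 < M1) (hM2 : 0 < M2) (hG : 0 < G)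
  (hRetr1 : forall X xi, Stiefel X -> tangent X xi ->
     fnorm (Retr X xi - X) <= M1 * fnorm xi)
  (hRetr2 : forall X xi, Stiefel X -> tangent X xi ->
     fnorm (Retr X xi - (X + xi)) <= M2 * fnorm xi ^+ 2)
  (hgradG : forall X, Stiefel X -> fnorm (egrad f X) <= G)
  (X0 : 'M[R]_(n, r)) (hX0 : Stiefel X0)
  (gamma : R) (hgamma0 : 0 < gamma) (hgamma1 : gamma < 1) :
  (forall t : R, 0 < t ->
     forall X : nat -> 'M[R]_(n, r), ManPG_seq f h Retr gamma t X0 X ->
     forall Y, cluster (X @ \oo) Y -> stationary f h Y) /\
  (forall eps : R, 0 < eps ->
     let t := L^-1 in
     let c0 := M2 * G + L * M1 ^+ 2 / 2 in
     let alphabar := (2 * (c0 + Lh * M2) * t)^-1 in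
     let Fstar := inf [set f X + h X | X in @Stiefel R n r] in
     exists (K : nat) (Y : 'M[R]_(n, r)),
       [/\ ManPG_returns f h Retr gamma t (eps / L) X0 K Y,
           K%:Z <= Num.ceil (2 * L * (f X0 + h X0 - Fstar) /
                             (gamma * alphabar * eps ^+ 2)) &
           eps_stationary f h L eps Y]).
Proof.
have [hRetr0 _ _ _] := hRetr; split=> [t t0 X seqX Y clY|eps eps0].
- exact: (limit_point_stationary hL hM1 hM2 hG hf hgrad hconv hLip hRetr0
    hRetr1 hRetr2 hgradG hX0 hgamma0 hgamma1 t0 seqX clY).
- exact: (complexity_bound hL hM1 hM2 hG hf hgrad hconv hLip hRetr0 hRetr1
    hRetr2 hgradG hX0 hgamma0 hgamma1 eps0).
Qed.
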